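(* Let $N\ge 2$ be a fixed integer and consider the undamped ($\gamma=0$) discrete nonlinear Schrödinger system in a rotating frame $$-i\,\frac{\partial w_j}{\partial t} = -\epsilon\,(\Delta w)_j - w_j + |w_j|^2 w_j,\qquad j=1,\dots,N,$$ for $w=(w_1,\dots,w_N)\in\mathbb{C}^N$. There exist constants $\epsilon_0>0$ and $\phi_0>0$ such that for all $0<\epsilon<\epsilon_0$ and all real $\phi$ with $|\phi|<\phi_0$, this system has a periodic solution of the form $$w_j(t;\phi)=e^{it\phi}\,p_j^*(\phi),\qquad j=1,\dots,N,$$ with $p_j^*(\phi)\in\mathbb{R}$ (depending also on $\epsilon$), where $p_1^*(\phi)=1+\mathcal{O}(\epsilon,\phi)$ and $p_j^*(\phi)=\mathcal{O}(\epsilon^{j-1})$ for $j=2,\dots,N$.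
   Context: The discrete Laplacian on the finite chain $\{1,\dots,N\}$ is $(\Delta w)_j = w_{j-1}-2w_j+w_{j+1}$ for $1<j<N$, with free ends: $(\Delta w)_1 = w_2-w_1$ and $(\Delta w)_N = w_{N-1}-w_N$. For $\phi=0$ the solution $w_j(t;0)=p_j^*(0)$ is a fixed point, regarded as a (trivially) periodic solution. The $\mathcal{O}$ notation is for $N$ fixed, with constants independent of $\epsilon$ and $\phi$ in the stated ranges: there is a constant $C>0$ (depending only on $N$) such that $|p_1^*(\phi)-1|\le C(\epsilon+|\phi|)$ and $|p_j^*(\phi)|\le C\epsilon^{j-1}$ for $j=2,\dots,N$, for all $0<\epsilon<\epsilon_0$ and $|\phi|<\phi_0$. *)

(* Defs.v *)
(* Stdlib reals with Coquelicot.  A vector of C^N is represented by a function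
   nat -> C of which only the components 1, ..., N are meaningful. *)
From Stdlib Require Import Reals Arith.
From Coquelicot Require Import Coquelicot.

Open Scope R_scope.

(* Free-end discrete Laplacian on the chain {1, ..., N}, for N >= 2. *)
Definition laplacian (N : nat) (w : nat -> C) (j : nat) : C :=
  if Nat.eqb j 1 then (w 2%nat - w 1%nat)%C
  else if Nat.eqb j N then (w (N - 1)%nat - w N)%C
  else (w (j - 1)%nat - RtoC 2 * w j + w (j + 1)%nat)%C.

Definition dnls_rhs (N : nat) (eps : R) (w : nat -> C) (j : nat) : C :=
  (- (RtoC eps * laplacian N w j) - w j + RtoC (Cmod (w j) ^ 2) * w j)%C.

(* [C_R_NormedModule] is C as a real normed space: [d] is the derivative of
   the curve t |-> w_j(t) with respect to the real variable t. *)
Definition is_dnls_solution (N : nat) (eps : R) (w : R -> nat -> C) : Prop :=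
  forall (j : nat), (1 <= j <= N)%nat ->
  forall (t : R), exists d : C,
    @is_derive R_AbsRing C_R_NormedModule (fun s : R => w s j) t d /\
    (- (Ci * d))%C = dnls_rhs N eps (w t) j.

(* Fixed points count as (trivially) periodic: [T] is any positive period. *)
Definition is_periodic (N : nat) (w : R -> nat -> C) : Prop :=
  exists T : R, 0 < T /\
    forall (t : R) (j : nat), (1 <= j <= N)%nat -> w (t + T) j = w t j.

(* e^{i theta} *)
Definition cexpi (theta : R) : C := (cos theta, sin theta).

(* Main.v *)
(** Inserting [e^{it phi} p] into the system leaves the real stationary
    equations [phi p_j = - eps (Delta p)_j - p_j + p_j^3].  With
    [p_j = (-eps)^(j-1) r_j] the equations for [j = N, ..., 2] become a polynomial
    recursion expressing [r_(j-1)] through [r_j] and [r_(j+1)], which for small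
    [eps] and [phi] is a perturbation of [r_(j-1) = r_j].  Starting from
    [r_N = a], the one equation left, that for [j = 1], is a perturbation of
    [a^3 - a = 0], and the intermediate value theorem on [[1/2, 2]] solves it. *)
Require Import Defs.
From Stdlib Require Import Reals Lra Lia ClassicalEpsilon.
From Coquelicot Require Import Coquelicot.

Set Bullet Behavior "Strict Subproofs".

Definition real_laplacian (N : nat) (p : nat -> R) (j : nat) : R :=
  if Nat.eqb j 1 then p 2%nat - p 1%nat
  else if Nat.eqb j N then p (N - 1)%nat - p N
  else p (j - 1)%nat - 2 * p j + p (j + 1)%nat.

Definition is_stationary (N : nat) (eps phi : R) (p : nat -> R) : Prop :=
  forall j : nat, (1 <= j <= N)%nat ->
    phi * p j = - (eps * real_laplacian N p j) - p j + p j ^ 3.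

(** * Rotating waves *)

Lemma laplacian_scal (N : nat) (c : C) (p : nat -> R) (j : nat) :
  laplacian N (fun i => (c * RtoC (p i))%C) j = (c * RtoC (real_laplacian N p j))%C.
Proof.
unfold laplacian, real_laplacian.
destruct (Nat.eqb j 1); [|destruct (Nat.eqb j N)];
  rewrite ?RtoC_plus, ?RtoC_minus, ?RtoC_mult; ring.
Qed.

Lemma Cmod_cexpi (theta : R) : Cmod (cexpi theta) = 1.
Proof.
unfold Cmod, cexpi; simpl fst; simpl snd.
replace (cos theta ^ 2 + sin theta ^ 2) with 1; [apply sqrt_1|].
generalize (sin2_cos2 theta); unfold Rsqr; intros; lra.
Qed.

Lemma Cmod_rotating (theta x : R) : Cmod (cexpi theta * RtoC x)%C ^ 2 = x ^ 2.
Proof.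
rewrite Cmod_mult, Cmod_cexpi, Cmod_R, Rmult_1_l.
apply pow2_abs.
Qed.

Lemma is_derive_rotating (phi x t : R) :
  @is_derive R_AbsRing C_R_NormedModule
    (fun s : R => (cexpi (s * phi) * RtoC x)%C) t
    (Ci * RtoC phi * (cexpi (t * phi) * RtoC x))%C.
Proof.
apply (is_derive_ext
  (fun s : R => ((cos (s * phi) * x, sin (s * phi) * x) : C))).
{ intros s; unfold cexpi, Cmult, RtoC; simpl.
  f_equal; ring. }
replace (Ci * RtoC phi * (cexpi (t * phi) * RtoC x))%C
  with ((- phi * sin (t * phi) * x, phi * cos (t * phi) * x) : C).
2:{ unfold cexpi, Cmult, RtoC, Ci; simpl; f_equal; ring. }
(* The curve is the pair of its real and imaginary parts. Pairing is linear, hence its own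
   differential, so two real derivatives suffice. *)
apply (filterdiff_ext_lin _
  (fun y : R => (scal y (- phi * sin (t * phi) * x),
                 scal y (phi * cos (t * phi) * x)))).
2:{ intros y; reflexivity. }
apply (filterdiff_comp_2 (fun s : R => cos (s * phi) * x)
  (fun s : R => sin (s * phi) * x) (fun u v : R => (u, v))
  (fun y : R => scal y (- phi * sin (t * phi) * x))
  (fun y : R => scal y (phi * cos (t * phi) * x)) (fun u v : R => (u, v))).
- change (is_derive (fun s : R => cos (s * phi) * x) t (- phi * sin (t * phi) * x)).
  auto_derive; [exact I|ring].
- change (is_derive (fun s : R => sin (s * phi) * x) t (phi * cos (t * phi) * x)).
  auto_derive; [exact I|ring].
- apply (filterdiff_ext (fun z : R * R => z)).
  { intros [u v]; reflexivity. }
  apply (filterdiff_ext_lin _ (fun z : R * R => z)).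
  2:{ intros [u v]; reflexivity. }
  apply filterdiff_id.
Qed.

(** Gauge invariance: the common phase factors out of the Laplacian and has modulus 1, while
    differentiating it gives [i phi], which [-i] turns into [phi]. What remains is the real
    stationary system. *)
Lemma rotating_solution (N : nat) (eps phi : R) (p : nat -> R) :
  is_stationary N eps phi p ->
  is_dnls_solution N eps (fun t j => (cexpi (t * phi) * RtoC (p j))%C).
Proof.
intros Hp j Hj t.
exists (Ci * RtoC phi * (cexpi (t * phi) * RtoC (p j)))%C; split.
{ apply is_derive_rotating. }
unfold dnls_rhs; rewrite laplacian_scal, Cmod_rotating.
assert (H : (RtoC phi * RtoC (p j)
  = - (RtoC eps * RtoC (real_laplacian N p j)) - RtoC (p j)
     + RtoC (p j ^ 2) * RtoC (p j))%C).
{ rewrite <- !RtoC_mult, <- RtoC_opp, <- RtoC_minus, <- RtoC_plus.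
  rewrite (Hp j Hj); f_equal; ring. }
transitivity (cexpi (t * phi) * (RtoC phi * RtoC (p j)))%C.
2:{ rewrite H; ring. }
transitivity ((- (Ci * Ci)) * (cexpi (t * phi) * (RtoC phi * RtoC (p j))))%C.
{ ring. }
replace (Ci * Ci)%C with (- RtoC 1)%C; [ring|].
unfold Ci, Cmult, Copp, RtoC; simpl; f_equal; ring.
Qed.

Lemma cexpi_2PI (theta : R) : cexpi (theta + 2 * PI) = cexpi theta.
Proof.
unfold cexpi; rewrite cos_plus, sin_plus, cos_2PI, sin_2PI; f_equal; ring.
Qed.

Lemma rotating_periodic (N : nat) (phi : R) (p : nat -> R) :
  is_periodic N (fun t j => (cexpi (t * phi) * RtoC (p j))%C).
Proof.
generalize PI_RGT_0; intros HPI.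
destruct (Req_dec phi 0) as [->|Hphi].
{ exists 1; split; [lra|]; intros t j _.
  now rewrite !Rmult_0_r. }
exists (2 * PI / Rabs phi); split.
{ apply Rdiv_lt_0_compat; [lra|now apply Rabs_pos_lt]. }
intros t j _; f_equal.
(* Over one period the phase changes by [2 * PI] times the sign of [phi]; for negative [phi] the
   turn is therefore added on the other side. *)
destruct (Rdichotomy _ _ Hphi) as [H|H].
- rewrite Rabs_left by exact H.
  rewrite <- cexpi_2PI; f_equal; field; lra.
- rewrite Rabs_right by lra.
  rewrite <- (cexpi_2PI (t * phi)); f_equal; field; lra.
Qed.

(** * The shooting recursion *)

(* [shoot N eps phi a k] is the pair [(r_j, eps^2 r_(j+1))] with [j = N - k].
   The free end means [p_(N+1) = p_N], that is [eps^2 r_(N+1) = - eps r_N]. *)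
Fixpoint shoot (N : nat) (eps phi a : R) (k : nat) : R * R :=
  match k with
  | O => (a, - (eps * a))
  | S k' =>
      let (s, u) := shoot N eps phi a k' in
      ((1 + phi - 2 * eps) * s - eps ^ (2 * (N - 1 - k')) * s ^ 3 - u, eps ^ 2 * s)
  end.

Definition profile (N : nat) (eps phi a : R) (j : nat) : R :=
  (- eps) ^ (j - 1) * fst (shoot N eps phi a (N - j)).

(** The stationary equation at the free end [j = 1], right side minus left: here [s = p_1] and
    [u = - eps p_2]. *)
Definition mismatch (N : nat) (eps phi a : R) : R :=
  let (s, u) := shoot N eps phi a (N - 1) in s ^ 3 - (1 + phi - eps) * s + u.

(** For [j >= 2] the equation is one recursion step multiplied by [(- eps) ^ (j - 1)]. Everything is
    phrased through [eps * p_(j-1)] and [eps * p_(j+1)], so no division by [eps] occurs. *)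
Lemma profile_stationary (N : nat) (eps phi a : R) :
  (2 <= N)%nat -> mismatch N eps phi a = 0 ->
  is_stationary N eps phi (profile N eps phi a).
Proof.
intros HN Ha j Hj; unfold real_laplacian.
destruct (Nat.eqb_spec j 1) as [->|Hj1].
{ unfold profile; unfold mismatch in Ha.
  replace (N - 1)%nat with (S (N - 2)) in Ha |- * by lia.
  simpl shoot in *.
  destruct (shoot N eps phi a (N - 2)) as [s u]; simpl fst in *.
  change (1 - 1)%nat with 0%nat; change (2 - 1)%nat with 1%nat.
  rewrite pow_1, pow_O, !Rmult_1_l.
  match type of Ha with ?x ^ 3 - _ + _ = 0 => set (y := x) in * end.
  symmetry; apply Rminus_diag_uniq; rewrite <- Ha; ring. }
assert (Hpow : eps ^ (2 * (N - 1 - (N - j))) = ((- eps) ^ (j - 1)) ^ 2).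
{ replace (N - 1 - (N - j))%nat with (j - 1)%nat by lia.
  rewrite pow_mult, <- !Rsqr_pow2, (Rsqr_neg eps), !Rsqr_pow2, <- !pow_mult.
  f_equal; lia. }
assert (Hprev : forall x, (- eps) ^ (j - 1) * x = - eps * (- eps) ^ (j - 1 - 1) * x).
{ intros x; replace (j - 1)%nat with (S (j - 1 - 1)) at 1 by lia; reflexivity. }
assert (Hdown : eps * profile N eps phi a (j - 1) = - (- eps) ^ (j - 1) *
  fst (shoot N eps phi a (S (N - j)))).
{ unfold profile; replace (N - (j - 1))%nat with (S (N - j)) by lia.
  generalize (Hprev 1); intros E; rewrite !Rmult_1_r in E; rewrite E; ring. }
cbn [shoot] in Hdown; rewrite Hpow in Hdown.
(* At [j = N] the starting value [- (eps * a)] turns the interior coefficient [1 + phi - 2 * eps]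
   into the free-end one, [1 + phi - eps]. *)
destruct (Nat.eqb_spec j N) as [->|HjN].
{ rewrite Nat.sub_diag in Hdown; cbn [shoot fst] in Hdown.
  unfold profile in *; rewrite Nat.sub_diag; simpl shoot; simpl fst.
  rewrite Rmult_minus_distr_l, Hdown; ring. }
assert (Hup : eps * profile N eps phi a (j + 1) =
  - (- eps) ^ (j - 1) * snd (shoot N eps phi a (N - j))).
{ unfold profile; replace (j + 1 - 1)%nat with (S (j - 1)) by lia.
  replace (N - j)%nat with (S (N - (j + 1))) by lia; simpl.
  destruct (shoot N eps phi a (N - (j + 1))) as [s u]; simpl; ring. }
rewrite Rmult_plus_distr_l, Rmult_minus_distr_l, Hdown, Hup; unfold profile.
destruct (shoot N eps phi a (N - j)) as [s u]; simpl fst; simpl snd; ring.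
Qed.

(** * Uniform bounds on the recursion *)

(** Each step changes [r_j] only by terms carrying [eps] or [phi], and the errors of finitely many
    steps add up. [K] is fixed before [eps], [phi] and [a], which gives the uniformity behind the
    O-estimates. *)
Lemma shoot_bound (N n : nat) :
  exists K : R, 0 < K /\
    forall eps phi a : R, 0 < eps < 1 -> Rabs phi < 1 -> 1 / 2 <= a <= 2 ->
    forall k : nat, (k <= n)%nat -> (k < N)%nat ->
      Rabs (fst (shoot N eps phi a k) - a) <= K * (eps + Rabs phi) /\
      Rabs (snd (shoot N eps phi a k)) <= K * (eps + Rabs phi).
Proof.
induction n as [|n [K [HK IH]]].
{ exists 2; split; [lra|]; intros eps phi a He Hphi Ha k Hk _.
  generalize (Rabs_pos phi); intros Hphi0.
  replace k with 0%nat by lia; simpl; split.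
  - rewrite Rminus_diag, Rabs_R0; lra.
  - rewrite Rabs_Ropp, Rabs_right by nra; nra. }
(* Bounds [s]: [a <= 2], and the inductive error is at most [2 * K] because [eps + Rabs phi < 2]. *)
set (M := 2 + 2 * K).
assert (HM : 2 <= M) by (unfold M; lra).
assert (HM3 : 0 < M ^ 3) by (apply pow_lt; lra).
(* One [K] each for the old errors in [s] and [u], [2 * M] for the linear term, [M ^ 3] for the
   cubic one. *)
exists (2 * K + 2 * M + M ^ 3); split; [lra|].
intros eps phi a He Hphi Ha k Hk HkN.
generalize (Rabs_pos phi); intros Hphi0.
destruct (Nat.eq_dec k (S n)) as [->|Hkn].
2:{ destruct (IH eps phi a He Hphi Ha k ltac:(lia) HkN) as [H1 H2].
  split; eapply Rle_trans; try eassumption; apply Rmult_le_compat_r; lra. }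
destruct (IH eps phi a He Hphi Ha n (le_n n) ltac:(lia)) as [H1 H2].
cbn [shoot]; destruct (shoot N eps phi a n) as [s u]; cbn [fst snd] in *.
set (delta := eps + Rabs phi) in *.
assert (Hdelta : 0 < delta < 2) by (unfold delta; lra).
assert (Hs : Rabs s <= M).
{ replace s with ((s - a) + a) by ring.
  eapply Rle_trans; [apply Rabs_triang|].
  rewrite (Rabs_right a) by lra; unfold M; nra. }
generalize (Rabs_pos s); intros Hs0.
(* The condition [S n < N] makes the exponent positive, so the cubic term is small. *)
assert (Hpow : 0 <= eps ^ (2 * (N - 1 - n)) <= eps).
{ split; [apply pow_le; lra|].
  replace (2 * (N - 1 - n))%nat with (S (2 * (N - 1 - n) - 1)) by lia.
  simpl; rewrite <- (Rmult_1_r eps) at 3.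
  apply Rmult_le_compat_l; [lra|].
  rewrite <- (pow1 (2 * (N - 1 - n) - 1)); apply pow_incr; lra. }
set (x := eps ^ (2 * (N - 1 - n))) in *.
assert (Hlin : Rabs ((phi - 2 * eps) * s) <= 2 * M * delta).
{ rewrite Rabs_mult.
  assert (Rabs (phi - 2 * eps) <= 2 * delta).
  { unfold delta; apply Rabs_le; generalize (Rle_abs phi) (Rle_abs (- phi)).
    rewrite Rabs_Ropp; lra. }
  replace (2 * M * delta) with ((2 * delta) * M) by ring.
  apply Rmult_le_compat; auto using Rabs_pos. }
assert (Hcub : Rabs (x * s ^ 3) <= M ^ 3 * delta).
{ rewrite Rabs_mult, (Rabs_right x) by lra; rewrite Rmult_comm.
  apply Rmult_le_compat; [apply Rabs_pos|lra| |unfold delta; lra].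
  rewrite <- RPow_abs; apply pow_incr; lra. }
split.
- replace (_ - a) with ((s - a) + ((phi - 2 * eps) * s + (- (x * s ^ 3) + - u))) by ring.
  eapply Rle_trans; [apply Rabs_triang|].
  eapply Rle_trans; [apply Rplus_le_compat_l, Rabs_triang|].
  eapply Rle_trans; [do 2 apply Rplus_le_compat_l; apply Rabs_triang|].
  rewrite !Rabs_Ropp; lra.
- replace (eps ^ 2 * s) with (eps * (eps * s)) by ring.
  rewrite !Rabs_mult, (Rabs_right eps) by lra.
  apply Rle_trans with (M * delta); [|nra].
  assert (eps * (eps * Rabs s) <= 1 * (eps * Rabs s)) by
    (apply Rmult_le_compat_r; nra).
  unfold delta; nra.
Qed.

(** * Continuity in the starting value *)

Lemma continuity_ext (f g : R -> R) :
  (forall x, f x = g x) -> continuity f -> continuity g.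
Proof. intros Hfg Hf x; exact (continuity_pt_ext f g x Hfg (Hf x)). Qed.

Lemma shoot_continuity (N : nat) (eps phi : R) (k : nat) :
  continuity (fun a => fst (shoot N eps phi a k)) /\
  continuity (fun a => snd (shoot N eps phi a k)).
Proof.
induction k as [|k [IHs IHu]]; cbn [shoot].
{ split; simpl; reg. }
set (s := fun a => fst (shoot N eps phi a k)) in IHs.
set (u := fun a => snd (shoot N eps phi a k)) in IHu.
split.
- apply (continuity_ext (fun a => (1 + phi - 2 * eps) * s a
    - eps ^ (2 * (N - 1 - k)) * s a ^ 3 - u a)).
  { intros a; unfold s, u; destruct (shoot N eps phi a k); reflexivity. }
  clearbody s u; reg.
- apply (continuity_ext (fun a => eps ^ 2 * s a)).
  { intros a; unfold s; destruct (shoot N eps phi a k); reflexivity. }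
  clearbody s; reg.
Qed.

Lemma mismatch_continuity (N : nat) (eps phi : R) : continuity (mismatch N eps phi).
Proof.
destruct (shoot_continuity N eps phi (N - 1)) as [Hs Hu].
set (s := fun a => fst (shoot N eps phi a (N - 1))) in Hs.
set (u := fun a => snd (shoot N eps phi a (N - 1))) in Hu.
apply (continuity_ext (fun a => s a ^ 3 - (1 + phi - eps) * s a + u a)).
{ intros a; unfold mismatch, s, u; destruct (shoot N eps phi a (N - 1)); reflexivity. }
clearbody s u; reg.
Qed.

(** * Solving the equation at site 1 *)

(** The difference [(s ^ 3 - s) - (a ^ 3 - a)] has the factor [s - a], controlled by [shoot_bound];
    the remaining terms are [u] and [(phi - eps) * s], both small. *)
Lemma mismatch_approx (N : nat) :
  (1 <= N)%nat ->
  exists K : R, 0 < K /\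
    forall eps phi a : R, 0 < eps < 1 -> Rabs phi < 1 -> 1 / 2 <= a <= 2 ->
      Rabs (mismatch N eps phi a - (a ^ 3 - a)) <= K * (eps + Rabs phi).
Proof.
intros HN; destruct (shoot_bound N (N - 1)) as [K [HK Hb]].
set (M := 2 + 2 * K).
assert (HM : 2 <= M) by (unfold M; lra).
exists (K * (3 * M ^ 2 + 2) + M); split; [nra|].
intros eps phi a He Hphi Ha.
destruct (Hb eps phi a He Hphi Ha (N - 1)%nat (le_n _) ltac:(lia)) as [H1 H2].
unfold mismatch; destruct (shoot N eps phi a (N - 1)) as [s u].
simpl fst in *; simpl snd in *.
generalize (Rabs_pos phi); intros Hphi0.
set (delta := eps + Rabs phi) in *.
assert (Hdelta : 0 < delta < 2) by (unfold delta; lra).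
assert (Hs : Rabs s <= M).
{ replace s with ((s - a) + a) by ring.
  eapply Rle_trans; [apply Rabs_triang|].
  rewrite (Rabs_right a) by lra; unfold M; nra. }
assert (Hlin : Rabs ((phi - eps) * s) <= delta * M).
{ rewrite Rabs_mult; apply Rmult_le_compat; auto using Rabs_pos.
  unfold delta; apply Rabs_le; generalize (Rle_abs phi) (Rle_abs (- phi)).
  rewrite Rabs_Ropp; lra. }
assert (Hq : Rabs (s ^ 2 + s * a + a ^ 2 - 1) <= 3 * M ^ 2 + 1).
{ apply Rabs_le_between in Hs; apply Rabs_le; nra. }
assert (Hcub : Rabs ((s - a) * (s ^ 2 + s * a + a ^ 2 - 1))
  <= (K * delta) * (3 * M ^ 2 + 1)).
{ rewrite Rabs_mult; apply Rmult_le_compat; auto using Rabs_pos. }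
replace (_ - (a ^ 3 - a)) with
  ((s - a) * (s ^ 2 + s * a + a ^ 2 - 1) + (- ((phi - eps) * s) + u)) by ring.
eapply Rle_trans; [apply Rabs_triang|].
eapply Rle_trans; [apply Rplus_le_compat_l, Rabs_triang|].
rewrite Rabs_Ropp; lra.
Qed.

Lemma mismatch_root (N : nat) :
  (1 <= N)%nat ->
  exists d K : R, 0 < d <= 1 /\ 0 < K /\
    forall eps phi : R, 0 < eps < d -> Rabs phi < d ->
    exists a : R, 1 / 2 <= a <= 2 /\ mismatch N eps phi a = 0 /\
      Rabs (a - 1) <= K * (eps + Rabs phi).
Proof.
intros HN; destruct (mismatch_approx N HN) as [K [HK Happrox]].
(* This makes the error less than 1/4, while [a ^ 3 - a] is -3/8 at 1/2 and 6 at 2, so the signs at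
   the endpoints persist. *)
exists (Rmin 1 (/ (8 * K))), (2 * K).
assert (Hinv : 0 < / (8 * K)) by (apply Rinv_0_lt_compat; lra).
assert (Hmin := conj (Rmin_l 1 (/ (8 * K))) (Rmin_r 1 (/ (8 * K)))).
split; [split; [apply Rmin_pos; lra|lra]|split; [lra|]].
intros eps phi He Hphi.
assert (He1 : 0 < eps < 1) by lra.
assert (Hphi1 : Rabs phi < 1) by lra.
assert (Hsmall : K * (eps + Rabs phi) < 1 / 4).
{ apply Rlt_le_trans with (K * (2 * / (8 * K))).
  - apply Rmult_lt_compat_l; lra.
  - apply Req_le; field; lra. }
destruct (IVT (mismatch N eps phi) (1 / 2) 2 (mismatch_continuity N eps phi))
  as [a [Ha Hroot]].
- lra.
- generalize (Happrox eps phi (1 / 2) He1 Hphi1 ltac:(lra)); intros H.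
  apply Rabs_le_between in H; lra.
- generalize (Happrox eps phi 2 He1 Hphi1 ltac:(lra)); intros H.
  apply Rabs_le_between in H; lra.
- exists a; split; [exact Ha|split; [exact Hroot|]].
  generalize (Happrox eps phi a He1 Hphi1 Ha); rewrite Hroot; intros H.
  (* On [[1/2, 2]] the cofactor of [a - 1] is at least 3/4, so the root lies within 4/3 of the error
     from 1. *)
  replace (0 - (a ^ 3 - a)) with (- ((a - 1) * (a * (a + 1)))) in H by ring.
  rewrite Rabs_Ropp, Rabs_mult, (Rabs_right (a * (a + 1))) in H by nra.
  generalize (Rabs_pos (a - 1)); intros H0.
  assert (3 / 4 <= a * (a + 1)) by nra.
  nra.
Qed.

Theorem theorem2p2 :
  forall N : nat, (2 <= N)%nat ->
  exists (eps0 phi0 : R) (p : R -> R -> nat -> R),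
    0 < eps0 /\ 0 < phi0 /\
    (forall eps phi : R, 0 < eps < eps0 -> Rabs phi < phi0 ->
       let w := fun (t : R) (j : nat) =>
                  (cexpi (t * phi) * RtoC (p eps phi j))%C in
       is_dnls_solution N eps w /\ is_periodic N w) /\
    (exists K : R, 0 < K /\
       forall eps phi : R, 0 < eps < eps0 -> Rabs phi < phi0 ->
         Rabs (p eps phi 1%nat - 1) <= K * (eps + Rabs phi) /\
         (forall j : nat, (2 <= j <= N)%nat ->
            Rabs (p eps phi j) <= K * eps ^ (j - 1))).
Proof.
intros N HN.
destruct (mismatch_root N ltac:(lia)) as [d [K1 [Hd [HK1 Hroot]]]].
destruct (shoot_bound N N) as [K2 [HK2 Hb]].
set (good := fun eps phi a => 1 / 2 <= a <= 2 /\ mismatch N eps phi a = 0 /\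
      Rabs (a - 1) <= K1 * (eps + Rabs phi)).
(* Choice turns the root for each pair into a function of [eps] and [phi]; outside the small range
   its value is arbitrary. *)
set (amp := fun eps phi => epsilon (inhabits 0) (good eps phi)).
assert (Hamp : forall eps phi, 0 < eps < d -> Rabs phi < d ->
  good eps phi (amp eps phi)).
{ intros eps phi He Hphi; apply epsilon_spec; exact (Hroot eps phi He Hphi). }
exists d, d, (fun eps phi => profile N eps phi (amp eps phi)).
split; [lra|split; [lra|split]].
{ intros eps phi He Hphi w; split; [|apply rotating_periodic].
  apply rotating_solution, profile_stationary; [exact HN|].
  apply (Hamp eps phi He Hphi). }
(* One constant for both bounds: [K1 + K2] serves [j = 1], and [2 * K2 + 2] bounds [r_j] for
   [j >= 2], since [a <= 2] and [eps + Rabs phi < 2]. *)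
exists (K1 + 2 * K2 + 2); split; [lra|].
intros eps phi He Hphi.
destruct (Hamp eps phi He Hphi) as [Ha [_ Ha1]].
set (a := amp eps phi) in *.
generalize (Rabs_pos phi); intros Hphi0.
assert (Hs : forall j, (1 <= j <= N)%nat ->
  Rabs (fst (shoot N eps phi a (N - j)) - a) <= K2 * (eps + Rabs phi)).
{ intros j Hj.
  apply (Hb eps phi a ltac:(lra) ltac:(lra) Ha (N - j)%nat); lia. }
split.
- unfold profile; rewrite Nat.sub_diag, pow_O, Rmult_1_l.
  generalize (Hs 1%nat ltac:(lia)); generalize (fst (shoot N eps phi a (N - 1))).
  intros s H1.
  replace (s - 1) with ((s - a) + (a - 1)) by ring.
  eapply Rle_trans; [apply Rabs_triang|nra].
- intros j Hj; unfold profile.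
  generalize (Hs j ltac:(lia)); generalize (fst (shoot N eps phi a (N - j))).
  intros s H1.
  rewrite Rabs_mult, <- RPow_abs, Rabs_Ropp, (Rabs_right eps), Rmult_comm by lra.
  apply Rmult_le_compat_r; [apply pow_le; lra|].
  replace s with ((s - a) + a) by ring.
  eapply Rle_trans; [apply Rabs_triang|].
  rewrite (Rabs_right a) by lra; nra.
Qed.
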